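(* For any frame $\mathfrak F\in\mathsf{LBWE}$: $\mathfrak F$ satisfies (B8) $\forall x\forall z\,(x\neq z\to\exists y\,B(x,y,z))$ if and only if the formula $\mathsf Cp\to\mathsf C\mathsf Cp$ is valid on $\mathfrak F$.
   Context: A 3-frame is $\langle W,B\rangle$, $B\subseteq W^3$; $\#(x,y,z)$ means pairwise distinct. $\mathsf{LBWE}$: 3-frames satisfying (B1) $B(x,y,z)\to\#(x,y,z)$; (B2) $B(x,y,z)\to B(z,y,x)$; (B3) $B(x,y,z)\to\neg B(x,z,y)$; (B4) $B(x,y,z)\wedge B(y,z,u)\to B(x,y,u)$; (B5) $B(x,y,z)\wedge B(y,u,z)\to B(x,y,u)$; (B6) $\#(x,y,z)\to B(x,y,z)\vee B(x,z,y)\vee B(y,x,z)$; (B7) $\forall y\exists x\exists z\,B(x,y,z)$. The binary modality is interpreted by $w\Vdash\langle B\rangle(\varphi,\psi)$ iff there are $x,y$ with $x\Vdash\varphi$, $y\Vdash\psi$, $B(x,w,y)$; $\mathsf C\varphi:=\langle B\rangle(\varphi,\varphi)$; $p$ is a propositional variable; validity means truth at all points under all valuations. *)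

(* Defs.v *)
Record frame3 : Type := Frame3 {
  point :> Type;
  betw : point -> point -> point -> Prop
}.

Arguments betw {f} x y z.

Definition distinct3 {W : Type} (x y z : W) : Prop :=
  x <> y /\ y <> z /\ x <> z.

Record LBWE (F : frame3) : Prop := {
  B1 : forall x y z : F, betw x y z -> distinct3 x y z;
  B2 : forall x y z : F, betw x y z -> betw z y x;
  B3 : forall x y z : F, betw x y z -> ~ betw x z y;
  B4 : forall x y z u : F, betw x y z -> betw y z u -> betw x y u;
  B5 : forall x y z u : F, betw x y z -> betw y u z -> betw x y u;
  B6 : forall x y z : F,
    distinct3 x y z -> betw x y z \/ betw x z y \/ betw y x z;
  B7 : forall y : F, exists x z : F, betw x y z
}.

Definition B8 (F : frame3) : Prop :=
  forall x z : F, x <> z -> exists y : F, betw x y z.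

(* Propositional variables are indexed by nat; falsum and implication are a
   functionally complete choice of Boolean primitives. *)
Inductive form : Type :=
| Var : nat -> form
| Bot : form
| Imp : form -> form -> form
| DiaB : form -> form -> form.

Definition C (phi : form) : form := DiaB phi phi.

(* The point of evaluation is the middle argument of the relation. *)
Fixpoint sat (F : frame3) (V : nat -> F -> Prop) (w : F) (phi : form) : Prop :=
  match phi with
  | Var n => V n w
  | Bot => False
  | Imp a b => sat F V w a -> sat F V w b
  | DiaB a b => exists x y : F, sat F V x a /\ sat F V y b /\ betw x w y
  end.

Definition valid (F : frame3) (phi : form) : Prop :=
  forall (V : nat -> F -> Prop) (w : F), sat F V w phi.

(* Main.v *)
(** A betweenness relation of this kind is a linear order up to reversal.
    If the order is dense and [w] lies between [x] and [y], then points chosen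
    between [x] and [w] and between [w] and [y] again lie between [x] and [y],
    and [w] lies between them.  Conversely, if nothing lies between [x] and
    [z], orient the line so that [x] precedes [z] and let [p] hold at [z] and
    at the points before [x].  Then [C p] holds at [x], but only at points up
    to [x], so [x] is not between two such points and [C (C p)] fails there. *)
From Stdlib Require Import Classical.
Require Import Defs.

Lemma betw_inner (F : frame3) (HF : LBWE F) (x y z u : F) :
  betw x y z -> betw x u y -> betw u y z.
Proof.
  intros H1 H2.
  apply (B2 _ HF), (B5 _ HF) with x; apply (B2 _ HF); assumption.
Qed.

Lemma betw_outer (F : frame3) (HF : LBWE F) (x y z u : F) :
  betw x y z -> betw x u y -> betw x u z.
Proof.
  intros H1 H2.
  apply (B4 _ HF) with y; [assumption | now apply betw_inner with x].
Qed.

(** [B7] puts [x] between some [a] and [c]. If [z] lies on the side of [a], then [c] is the required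
    point; otherwise [a] is. *)
Lemma betw_extend (F : frame3) (HF : LBWE F) (x z : F) :
  x <> z -> exists a : F, betw a x z.
Proof.
  intros Hxz.
  destruct (B7 _ HF x) as (a & c & Hac).
  destruct (classic (a = z)) as [<- | Haz].
  { exists c; now apply (B2 _ HF). }
  destruct (B1 _ HF _ _ _ Hac) as (Hax & _ & _).
  destruct (B6 _ HF a z x) as [H | [H | H]].
  - repeat split; auto.
  - exists c; apply (B5 _ HF) with a; now apply (B2 _ HF).
  - now exists a.
  - exists c; apply (B4 _ HF) with a; now apply (B2 _ HF).
Qed.

(** If [z] separated [s] from [t], it would by [B5] also separate [x] from [t], against [B3]. *)
Lemma not_betw_same_side (F : frame3) (HF : LBWE F) (x z s t : F) :
  betw s x z -> betw t x z -> ~ betw s z t.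
Proof.
  intros Hs Ht H.
  apply (B3 _ HF _ _ _ Ht), (B5 _ HF) with s; now apply (B2 _ HF).
Qed.

Lemma same_side_cases (F : frame3) (HF : LBWE F) (x z s t : F) :
  betw s x z -> betw t x z -> s <> t -> betw s t z \/ betw t s z.
Proof.
  intros Hs Ht Hst.
  destruct (B1 _ HF _ _ _ Hs) as (_ & _ & Hsz).
  destruct (B1 _ HF _ _ _ Ht) as (_ & _ & Htz).
  destruct (B6 _ HF s t z) as [H | [H | H]]; [repeat split; auto | auto | | auto].
  now destruct (not_betw_same_side _ HF x z s t).
Qed.

(** Whichever of [s] and [t] is nearer to [z] lies between the other and [x], so [x] cannot lie
    between them. *)
Lemma not_betw_apex (F : frame3) (HF : LBWE F) (x z s t : F) :
  betw s x z -> betw t x z -> ~ betw s x t.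
Proof.
  intros Hs Ht H.
  destruct (B1 _ HF _ _ _ H) as (_ & _ & Hst).
  destruct (same_side_cases _ HF x z s t Hs Ht Hst) as [K | K].
  - apply (B3 _ HF _ _ _ H), (B5 _ HF) with z; assumption.
  - apply (B3 _ HF _ _ _ (B2 _ HF _ _ _ H)), (B5 _ HF) with z; assumption.
Qed.

Section Gap.

Variables (F : frame3) (HF : LBWE F) (x z : F).
Hypothesis gap : forall y : F, ~ betw x y z.

Lemma before_gap (s y : F) :
  betw s x z -> betw s y z -> y <> x -> betw y x z.
Proof.
  intros Hs Hy Hyx.
  destruct (B1 _ HF _ _ _ Hs) as (_ & Hxz & _).
  destruct (B1 _ HF _ _ _ Hy) as (_ & Hyz & _).
  destruct (B6 _ HF y x z) as [H | [H | H]]; [repeat split; auto | assumption | |].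
  (* Here [z] lies between [y] and [x], hence between [s] and [x], contradicting [Hs]. *)
  - exfalso; apply (B3 _ HF _ _ _ Hs), (B2 _ HF), (B4 _ HF) with y;
      now apply (B2 _ HF).
  - now destruct (gap y).
Qed.

(** For the valuation of the converse direction, this bounds the truth set of [C p]: its points
    other than [x] all lie before [x]. *)
Lemma between_before_gap (s t y : F) :
  betw s x z \/ s = z -> betw t x z \/ t = z -> betw s y t -> y <> x ->
  betw y x z.
Proof.
  intros [Hs | ->] [Ht | ->] Hy Hyx.
  - destruct (B1 _ HF _ _ _ Hy) as (_ & _ & Hst).
    destruct (same_side_cases _ HF x z s t Hs Ht Hst) as [K | K].
    + apply before_gap with s; [assumption | | assumption].
      now apply betw_outer with t.
    + apply before_gap with t; [assumption | | assumption].
      apply betw_outer with s; [assumption | assumption | now apply (B2 _ HF)].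
  - now apply before_gap with s.
  - apply before_gap with t; [assumption | now apply (B2 _ HF) | assumption].
  - now destruct (B1 _ HF _ _ _ Hy) as (_ & _ & Hzz).
Qed.

End Gap.

Theorem theorem6p2 (F : frame3) (HF : LBWE F) (p : nat) :
  B8 F <-> valid F (Imp (C (Var p)) (C (C (Var p)))).
Proof.
  split.
  - intros Hd V w (x & y & Hx & Hy & H).
    destruct (B1 _ HF _ _ _ H) as (Hxw & Hwy & _).
    destruct (Hd x w Hxw) as (u & Hu).
    destruct (Hd w y Hwy) as (v & Hv).
    exists u, v; split; [| split].
    + exists x, y; repeat split; trivial.
      now apply (betw_outer _ HF) with w.
    + exists x, y; repeat split; trivial.
      apply (B2 _ HF), (betw_outer _ HF) with w; now apply (B2 _ HF).
    + apply (B5 _ HF) with y; [now apply (betw_inner _ HF) with x | assumption].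
  - intros Hval x z Hxz.
    apply NNPP; intros Hgap.
    assert (gap : forall y : F, ~ betw x y z) by (intros y Hy; eauto).
    destruct (betw_extend _ HF x z Hxz) as (a & Ha).
    (* The valuation ignores the index, so it serves any [p]; [a] and [z] witness [C p] at [x]. *)
    destruct (Hval (fun _ y => betw y x z \/ y = z) x)
      as (u & v & (s1 & t1 & Hs1 & Ht1 & Hu) & (s2 & t2 & Hs2 & Ht2 & Hv) & H).
    { exists a, z; simpl; auto. }
    destruct (B1 _ HF _ _ _ H) as (Hux & Hxv & _).
    apply (not_betw_apex _ HF x z u v); [| | assumption].
    + now apply between_before_gap with s1 t1.
    + apply between_before_gap with s2 t2; auto.
Qed.
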